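(* Let $\mathcal X_1,\mathcal X_2$ be finite sets of secret input values, let $\mathcal W_1,\mathcal W_2$ be sets of guesses, let $g_1:\mathcal W_1\times\mathcal X_1\to[0,1]$ and $g_2:\mathcal W_2\times\mathcal X_2\to[0,1]$ be gain functions, and let $g:(\mathcal W_1\times\mathcal W_2)\times(\mathcal X_1\times\mathcal X_2)\to[0,1]$ be a joint gain function for $g_1,g_2$. For any prior $\pi$ on $\mathcal X_1\times\mathcal X_2$, with marginals $\pi_1,\pi_2$, $$H_g(\pi)\ \ge\ H_{g_1}(\pi_1)+H_{g_2}(\pi_2)+\log M^{\min}_{g,\pi}.$$
   Context: A prior on a finite set $\mathcal X$ is a probability distribution on $\mathcal X$. For a set $\mathcal W$ of guesses and a gain function $g:\mathcal W\times\mathcal X\to[0,1]$, the prior $g$-vulnerability is $V_g(\pi)=\max_{w\in\mathcal W}\sum_{x\in\mathcal X}\pi[x]g(w,x)$ and the $g$-entropy is $H_g(\pi)=-\log V_g(\pi)$. For the joint gain function, the guess set is $\mathcal W_1\times\mathcal W_2$ and the secret set is $\mathcal X_1\times\mathcal X_2$. Logarithms are to base 2. A joint gain function $g$ for $g_1,g_2$ is required to satisfy: $g((w_1,w_2),(x_1,x_2))=0$ if and only if $g_1(w_1,x_1)g_2(w_2,x_2)=0$ (no other relation is assumed). The marginals of $\pi$ are $\pi_1[x_1]=\sum_{x_2\in\mathcal X_2}\pi[x_1,x_2]$ and $\pi_2[x_2]=\sum_{x_1\in\mathcal X_1}\pi[x_1,x_2]$. For $w_1\in\mathcal W_1,w_2\in\mathcal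 W_2$ let $\mathcal S_{w_1,w_2}=\{(x_1,x_2)\in\mathcal X_1\times\mathcal X_2:\pi[x_1,x_2]\cdot g((w_1,w_2),(x_1,x_2))\ne0\}$, and define $$M^{\min}_{g,\pi}=\min_{w_1\in\mathcal W_1,\,w_2\in\mathcal W_2}\ \min_{(x_1,x_2)\in\mathcal S_{w_1,w_2}}\frac{\pi_1[x_1]g_1(w_1,x_1)\cdot\pi_2[x_2]g_2(w_2,x_2)}{\pi[x_1,x_2]\cdot g((w_1,w_2),(x_1,x_2))}.$$ *)

(* Defs.v *)
From mathcomp Require Import all_boot all_order all_algebra.
From mathcomp Require Import all_classical all_reals all_analysis.

Set Implicit Arguments.
Unset Strict Implicit.
Unset Printing Implicit Defensive.

Import Order.TTheory GRing.Theory Num.Theory.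
Local Open Scope classical_set_scope.
Local Open Scope ring_scope.

(* Guess sets are arbitrary types, so maxima and minima over guesses are taken
   as suprema and infima in \bar R; they agree with the max and min whenever
   these exist, and the infimum over the empty set is +oo. *)

Definition is_prior (R : realType) (X : finType) (p : X -> R) : Prop :=
  (forall x, 0 <= p x) /\ \sum_(x : X) p x = 1.

Definition is_gain (R : realType) (W X : Type) (g : W -> X -> R) : Prop :=
  forall w x, 0 <= g w x <= 1.

Definition is_joint_gain (R : realType) (W1 W2 X1 X2 : Type)
    (g1 : W1 -> X1 -> R) (g2 : W2 -> X2 -> R)
    (g : W1 * W2 -> X1 * X2 -> R) : Prop :=
  is_gain g /\
  forall w1 w2 x1 x2,
    g (w1, w2) (x1, x2) = 0 <-> g1 w1 x1 * g2 w2 x2 = 0.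

Definition marginal1 (R : realType) (X1 X2 : finType)
    (p : X1 * X2 -> R) (x1 : X1) : R := \sum_(x2 : X2) p (x1, x2).

Definition marginal2 (R : realType) (X1 X2 : finType)
    (p : X1 * X2 -> R) (x2 : X2) : R := \sum_(x1 : X1) p (x1, x2).

(* [lne 0 = -oo] and [lne +oo = +oo], unlike the total real function [ln],
   for which [ln 0 = 0]. *)
Definition log2e (R : realType) (x : \bar R) : \bar R :=
  (lne x * (ln 2)^-1%:E)%E.

Definition vulnerability (R : realType) (W : Type) (X : finType)
    (g : W -> X -> R) (p : X -> R) : \bar R :=
  ereal_sup [set (\sum_(x : X) p x * g w x)%:E | w in [set: W]].

Definition gentropy (R : realType) (W : Type) (X : finType)
    (g : W -> X -> R) (p : X -> R) : \bar R :=
  (- log2e (vulnerability g p))%E.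

Definition Ssupp (R : realType) (W1 W2 : Type) (X1 X2 : finType)
    (g : W1 * W2 -> X1 * X2 -> R) (p : X1 * X2 -> R)
    (w1 : W1) (w2 : W2) : set (X1 * X2) :=
  [set x | p x * g (w1, w2) x != 0].

(* When [Ssupp g p w1 w2] is empty the inner infimum is +oo, so the pair
   (w1, w2) does not contribute to the outer one. *)
Definition Mmin (R : realType) (W1 W2 : Type) (X1 X2 : finType)
    (g1 : W1 -> X1 -> R) (g2 : W2 -> X2 -> R)
    (g : W1 * W2 -> X1 * X2 -> R) (p : X1 * X2 -> R) : \bar R :=
  ereal_inf [set
    ereal_inf [set
      ((marginal1 p x.1 * g1 w.1 x.1 * (marginal2 p x.2 * g2 w.2 x.2))
         / (p x * g w x))%:E
      | x in Ssupp g p w.1 w.2]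
    | w in [set: W1 * W2]].

(* Main.v *)
Require Import Defs.
From mathcomp Require Import all_boot all_order all_algebra.
From mathcomp Require Import all_classical all_reals all_analysis.
From mathcomp Require Import lra.

(**
With [p1], [p2] the marginals of [p] and [M := Mmin g1 g2 g p],
[M * (p x * g w x) <= (p1 x1 * g1 w1 x1) * (p2 x2 * g2 w2 x2)] for every guess
[w] and secret [x]. Summing over [x], the right-hand side factors, so
[M * V_g <= V_g1 * V_g2]; take logarithms. Degenerate values are harmless: if
[V_g <= 0] the left-hand side is [+oo], and if [M = 0] the right-hand side is
[-oo].
*)

Set Implicit Arguments.
Unset Strict Implicit.
Unset Printing Implicit Defensive.

Import Order.TTheory GRing.Theory Num.Theory.
Local Open Scope classical_set_scope.
Local Open Scope ring_scope.

Lemma prior_gain_ge0 (R : realType) (W : Type) (X : finType)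
  (g : W -> X -> R) (p : X -> R) :
  is_gain g -> is_prior p -> forall w x, 0 <= p x * g w x.
Proof. by move=> hg [p0 _] w x; case/andP: (hg w x) => *; rewrite mulr_ge0. Qed.

Lemma sum_prior_gain_le1 (R : realType) (W : Type) (X : finType)
  (g : W -> X -> R) (p : X -> R) :
  is_gain g -> is_prior p -> forall w, \sum_x p x * g w x <= 1.
Proof.
move=> hg [p0 <-] w; apply: ler_sum => x _.
by apply: ler_piMr => //; case/andP: (hg w x).
Qed.

Lemma sum_prior_gain_ge0 (R : realType) (W : Type) (X : finType)
  (g : W -> X -> R) (p : X -> R) :
  is_gain g -> is_prior p -> forall w, 0 <= \sum_x p x * g w x.
Proof. by move=> hg hp w; apply: sumr_ge0 => x _; apply: prior_gain_ge0. Qed.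

Lemma ge_vulnerability (R : realType) (W : Type) (X : finType)
  (g : W -> X -> R) (p : X -> R) w :
  ((\sum_x p x * g w x)%:E <= vulnerability g p)%E.
Proof. by apply: ereal_sup_ubound; exists w. Qed.

(** The guess [w] rules out [-oo], the supremum over an empty guess set; gains at most 1 rule out
    [+oo]. *)
Lemma vulnerability_fin_num (R : realType) (W : Type) (X : finType)
  (g : W -> X -> R) (p : X -> R) (w : W) :
  is_gain g -> is_prior p -> vulnerability g p \is a fin_num.
Proof.
move=> hg hp; rewrite fin_numElt.
rewrite (lt_le_trans (ltNyr _) (ge_vulnerability g p w)).
apply: (@le_lt_trans _ _ 1%E); last exact: ltry.
apply: ge_ereal_sup => _ [v _ <-]; rewrite lee_fin.
exact: sum_prior_gain_le1.
Qed.

Lemma is_prior_marginal1 (R : realType) (X1 X2 : finType) (p : X1 * X2 -> R) :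
  is_prior p -> is_prior (marginal1 p).
Proof.
move=> [p0 p1]; split=> [x|]; first exact: sumr_ge0.
by rewrite -p1 pair_bigA; apply: eq_bigr => -[].
Qed.

Lemma is_prior_marginal2 (R : realType) (X1 X2 : finType) (p : X1 * X2 -> R) :
  is_prior p -> is_prior (marginal2 p).
Proof.
move=> [p0 p1]; split=> [x|]; first exact: sumr_ge0.
by rewrite -p1 exchange_big pair_bigA; apply: eq_bigr => -[].
Qed.

Lemma log2e_le0 (R : realType) (x : \bar R) : (x <= 0 -> log2e x = -oo)%E.
Proof.
move=> x0; rewrite /log2e le0_lneNy// mulNyr gtr0_sg ?mul1e//.
by rewrite invr_gt0 ln_gt0// ltr1n.
Qed.

Lemma log2e_EFin (R : realType) (r : R) :
  0 < r -> log2e r%:E = (ln r / ln 2)%:E.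
Proof. by move=> r0; rewrite /log2e lne_EFin. Qed.

Section Mmin.
Variables (R : realType) (X1 X2 : finType) (W1 W2 : Type).
Variables (g1 : W1 -> X1 -> R) (g2 : W2 -> X2 -> R).
Variables (g : W1 * W2 -> X1 * X2 -> R) (p : X1 * X2 -> R).
Hypotheses (hg1 : is_gain g1) (hg2 : is_gain g2) (hg : is_gain g).
Hypothesis hp : is_prior p.

Let prod_gain w x : R :=
  marginal1 p x.1 * g1 w.1 x.1 * (marginal2 p x.2 * g2 w.2 x.2).

Lemma prod_gain_ge0 w x : 0 <= prod_gain w x.
Proof.
have [m1 _] := is_prior_marginal1 hp; have [m2 _] := is_prior_marginal2 hp.
case/andP: (hg1 w.1 x.1) => a _; case/andP: (hg2 w.2 x.2) => b _.
by rewrite !mulr_ge0.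
Qed.

Lemma Mmin_ge0 : (0 <= Mmin g1 g2 g p)%E.
Proof.
apply: le_ereal_inf_tmp => _ [w _ <-]; apply: le_ereal_inf_tmp => _ [x _ <-].
by rewrite lee_fin divr_ge0 ?prior_gain_ge0 ?prod_gain_ge0.
Qed.

Lemma Mmin_le w x : p x * g w x != 0 ->
  (Mmin g1 g2 g p <= (prod_gain w x / (p x * g w x))%:E)%E.
Proof.
move=> h; apply: ge_ereal_inf; eexists; first by exists w.
(* [Ssupp] is indexed by [w.1] and [w.2], so [w] is split to match [h]. *)
by apply: ge_ereal_inf; eexists; first by exists x => //; case: w h.
Qed.

(** The product of sums expands into a sum over pairs, and the comparison is termwise: a term with
    [p x * g w x = 0] only needs [prod_gain_ge0], any other clears the denominator in [Mmin_le]. A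
    real [m] below the infimum keeps the computation in [R]. *)
Lemma Mmin_mul_le (m : R) w : (m%:E <= Mmin g1 g2 g p)%E ->
  m * (\sum_x p x * g w x) <=
  (\sum_x marginal1 p x * g1 w.1 x) * (\sum_x marginal2 p x * g2 w.2 x).
Proof.
move=> mM; rewrite big_distrlr pair_bigA mulr_sumr; apply: ler_sum => x _.
have [->|h] := eqVneq (p x * g w x) 0; first by rewrite mulr0 prod_gain_ge0.
rewrite -ler_pdivlMr; last by rewrite lt_neqAle eq_sym h prior_gain_ge0.
by rewrite -lee_fin; apply: le_trans mM _; apply: Mmin_le.
Qed.

End Mmin.

Theorem proposition3p5 (R : realType) (X1 X2 : finType) (W1 W2 : Type)
  (g1 : W1 -> X1 -> R) (g2 : W2 -> X2 -> R) (g : W1 * W2 -> X1 * X2 -> R)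
  (hg1 : is_gain g1) (hg2 : is_gain g2) (hg : is_joint_gain g1 g2 g)
  (p : X1 * X2 -> R) (hp : is_prior p) :
  (gentropy g p >=
   gentropy g1 (marginal1 p) + gentropy g2 (marginal2 p)
   + log2e (Mmin g1 g2 g p))%E.
Proof.
rewrite /gentropy; case: hg => {}hg _.
(* The first case includes an empty guess set, where the vulnerability is [-oo]. *)
have [Vle0|Vgt0] := leP (vulnerability g p) 0%E.
  by rewrite (log2e_le0 Vle0) leey.
(* This guess with positive expected gain makes all three vulnerabilities finite. Its sum has a
   nonzero term, which bounds [Mmin] away from [+oo]. *)
have [_ [w _ <-]] := ereal_sup_gt Vgt0; rewrite lte_fin => Sgt0.
have hp1 := is_prior_marginal1 hp; have hp2 := is_prior_marginal2 hp.
have Mfin : Mmin g1 g2 g p \is a fin_num.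
  have [x h] : exists x, p x * g w x != 0.
    apply/existsP; apply: contraLR Sgt0 => /existsPn h.
    by rewrite big1 ?ltxx// => x _; apply/eqP/negPn/h.
  rewrite fin_numElt (lt_le_trans (ltNyr 0))/= ?(Mmin_ge0 hg1 hg2 hg hp)//.
  by rewrite (le_lt_trans (Mmin_le _ _ h)) ?ltry.
(* Over infinitely many guesses, positive ratios can have infimum 0. Then [-oo] absorbs the other
   summands, even [+oo]. *)
have [Mle0|] := leP (Mmin g1 g2 g p) 0%E.
  by rewrite (log2e_le0 Mle0) addeNy leNye.
move: (vulnerability_fin_num w hg hp) => /fineK VE; move: Vgt0.
move: (vulnerability_fin_num w.1 hg1 hp1) => /fineK V1E.
move: (vulnerability_fin_num w.2 hg2 hp2) => /fineK V2E.
move: Mfin => /fineK ME; rewrite -VE -V1E -V2E -ME !lte_fin => vgt0 mgt0.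
set v := fine _ in VE vgt0 *.
set v1 := fine _ in V1E *; set v2 := fine _ in V2E *.
set m := fine _ in ME mgt0 *.
have S1_le u : 0 <= \sum_x marginal1 p x * g1 u x <= v1.
  by rewrite sum_prior_gain_ge0//= -lee_fin V1E ge_vulnerability.
have S2_le u : 0 <= \sum_x marginal2 p x * g2 u x <= v2.
  by rewrite sum_prior_gain_ge0//= -lee_fin V2E ge_vulnerability.
have mv_le : m * v <= v1 * v2.
  (* Dividing by [m > 0] makes the claim an upper bound on a supremum, checked guess by guess. *)
  rewrite mulrC -ler_pdivlMr// -lee_fin VE.
  apply: ge_ereal_sup => _ [u _ <-]; rewrite lee_fin ler_pdivlMr// mulrC.
  have mM : (m%:E <= Mmin g1 g2 g p)%E by rewrite ME.
  apply: le_trans (Mmin_mul_le hg1 hg2 hg hp u mM) _.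
  case/andP: (S1_le u.1) => ? ?; case/andP: (S2_le u.2) => ? ?.
  exact: ler_pM.
have v1_ge0 : 0 <= v1 by case/andP: (S1_le w.1); exact: le_trans.
have v2_ge0 : 0 <= v2 by case/andP: (S2_le w.2); exact: le_trans.
have mvgt0 : 0 < m * v by rewrite mulr_gt0.
(* Since [v1 * v2] dominates the positive [m * v], neither factor vanishes and both logarithms are
   finite. *)
have v12_gt0 := lt_le_trans mvgt0 mv_le.
have v1gt0 : 0 < v1.
  rewrite lt_neqAle v1_ge0 andbT.
  by apply: contraTneq v12_gt0 => <-; rewrite mul0r ltxx.
have v2gt0 : 0 < v2.
  rewrite lt_neqAle v2_ge0 andbT.
  by apply: contraTneq v12_gt0 => <-; rewrite mulr0 ltxx.
(* With all logarithms finite, the common factor [(ln 2)^-1] is pulled out and cancelled, leaving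
   natural logarithms of [mv_le]. *)
rewrite !log2e_EFin// -!EFinN -!EFinD lee_fin -!mulNr -!mulrDl.
rewrite ler_wpM2r ?invr_ge0 ?ln_ge0 ?ler1n//.
have : ln (m * v) <= ln (v1 * v2) by rewrite ler_ln ?posrE.
by rewrite !lnM ?posrE//; lra.
Qed.
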